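(* Let $X=(x_{ij})_{i,j=1}^n$ and $Y=(y_{ij})_{i,j=1}^n$ be symmetric matrices of indeterminates $\mathbf{x}=(x_{ij})_{i\le j}$ and $\mathbf{y}=(y_{ij})_{i\le j}$. Then $$\mathop{\mathbb{E}}_{\mathbf{s}^{(1)},\mathbf{s}^{(2)}}\det\big(X^{\mathbf{s}^{(1)}}+Y^{\mathbf{s}^{(2)}}\big)=\sum_{S\subseteq[n]}\ \prod_{i\in[n]\setminus S}(x_{ii}+y_{ii})\sum_{S_1\sqcup S_2=S}\mu(G_X[S_1],\mathbf{0}\oplus\mathbf{x})\,\mu(G_Y[S_2],\mathbf{0}\oplus\mathbf{y}),$$ where the expectation is over independent uniformly random signings $\mathbf{s}^{(1)},\mathbf{s}^{(2)}$, and the inner sum is over all ordered pairs $(S_1,S_2)$ of (possibly empty) disjoint sets with union $S$.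
   Context: $[n]=\{1,\dots,n\}$. A signing is an element $\mathbf{s}=(s_{ij})_{i<j}\in\{\pm1\}^{\binom n2}$, with $s_{ji}=s_{ij}$. For a symmetric matrix $A=(a_{ij})$, $A^{\mathbf{s}}$ is the symmetric matrix with off-diagonal entries $s_{ij}a_{ij}$ ($i\ne j$) and with the same diagonal entries $a_{ii}$ as $A$. Thus all signs $s^{(1)}_{ij},s^{(2)}_{ij}$ ($i<j$) are independent and uniform on $\{\pm1\}$. $G_X$ and $G_Y$ are the weighted graphs on vertex set $[n]$ corresponding to $X$ and $Y$: the edge $ij$ ($i\neq j$) carries the variable $x_{ij}$, respectively $y_{ij}$ (loops play no role in matchings). For $S\subseteq [n]$, $G[S]$ is the induced subgraph on $S$. For a graph $G=(V,E)$ with vertex variables $\mathbf{x}$ and edge variables $\mathbf{w}$, $\mu(G,\mathbf{x}\oplus\mathbf{w})=\sum_{M}(-1)^{|M|}\prod_{v\notin V(M)}x_v\prod_{e\in M}w_e^2$, the sum being over all matchings $M$ of $G$, where $V(M)$ is the set of vertices covered by $M$. In particular, setting the vertex variables to zero, $\mu(G_X[S_1],\mathbf{0}\oplus\mathbf{x})=\sum_{M}(-1)^{|M|}\prod_{ij\in M}x_{ij}^2$, the sum being over perfect matchings $M$ of the complete graph on $S_1$ (equal to $1$ if $S_1=\emptyset$ and to $0$ if $|S_1|$ is odd); similarly for $Y$. *)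

(* Defs.v *)
From HB Require Import structures.
From mathcomp Require Import all_boot all_order all_algebra.
From mathcomp Require Import mpoly.

Set Implicit Arguments.
Unset Strict Implicit.
Unset Printing Implicit Defensive.

Import Order.TTheory GRing.Theory Num.Theory.
Local Open Scope ring_scope.

(* An unordered pair {i, j} with i != j is encoded by the ordered pair i < j. *)
Definition edge (n : nat) : predArgType :=
  {p : 'I_n * 'I_n | (p.1 < p.2)%N}.

Definition ends (n : nat) (e : edge n) : {set 'I_n} :=
  [set (val e).1; (val e).2].

(* true encodes the sign -1 and false the sign +1. *)
Definition signing (n : nat) : predArgType := {ffun edge n -> bool}.

(* insub (i, j) is Some e exactly when i < j, so the two nested tests cover
   the entries above and below the diagonal; the last branch is i = j. *)
Definition signed_mx (A : comNzRingType) (n : nat) (s : signing n)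
    (M : 'M[A]_n) : 'M[A]_n :=
  \matrix_(i < n, j < n)
    if (insub (i, j) : option (edge n)) is Some e then (-1) ^+ s e * M i j
    else if (insub (j, i) : option (edge n)) is Some e then (-1) ^+ s e * M i j
    else M i j.

Definition uniform_mean (R : numFieldType) (V : lmodType R) (T : finType)
    (f : T -> V) : V :=
  (#|T|%:R : R)^-1 *: \sum_(t : T) f t.

Record graph (n : nat) := Graph {
  vertices : {set 'I_n};
  edges : {set edge n};
  edges_ends : {in edges, forall e, ends e \subset vertices}
}.

Lemma complete_ends (n : nat) :
  {in [set: edge n], forall e, ends e \subset [set: 'I_n]}.
Proof. by move=> e _; apply: subsetT. Qed.

Definition complete_graph (n : nat) : graph n := Graph (@complete_ends n).

Lemma induced_ends (n : nat) (G : graph n) (S : {set 'I_n}) :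
  {in [set e in edges G | ends e \subset S],
    forall e, ends e \subset vertices G :&: S}.
Proof. by move=> e; rewrite inE subsetI => /andP[/edges_ends-> ->]. Qed.

Definition induced (n : nat) (G : graph n) (S : {set 'I_n}) : graph n :=
  Graph (@induced_ends n G S).

Definition is_matching (n : nat) (G : graph n) (M : {set edge n}) : bool :=
  (M \subset edges G) &&
  [forall e in M, forall f in M, (e != f) ==> [disjoint ends e & ends f]].

Definition covered (n : nat) (M : {set edge n}) : {set 'I_n} :=
  \bigcup_(e in M) ends e.

Definition matching_poly (A : comNzRingType) (n : nat) (G : graph n)
    (x : 'I_n -> A) (w : edge n -> A) : A :=
  \sum_(M : {set edge n} | is_matching G M)
    (-1) ^+ #|M| * (\prod_(v in vertices G :\: covered M) x v)
    * (\prod_(e in M) w e ^+ 2).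

Definition edge_weight (A : comNzRingType) (n : nat) (M : 'M[A]_n)
    (e : edge n) : A := M (val e).1 (val e).2.

(* Indices (i, j) with i <= j of the entries of a symmetric matrix. *)
Definition upper (n : nat) : predArgType :=
  {p : 'I_n * 'I_n | (p.1 <= p.2)%N}.

Lemma sort_pair_subproof (n : nat) (i j : 'I_n) :
  let p := if (i <= j)%N then (i, j) else (j, i) in (p.1 <= p.2)%N.
Proof. by case: leqP => //= /ltnW. Qed.

Definition sort_pair (n : nat) (i j : 'I_n) : upper n :=
  exist (fun p : 'I_n * 'I_n => (p.1 <= p.2)%N) _ (sort_pair_subproof i j).

(* The left summand indexes the variables x_ij and the right one the y_ij. *)
Definition nvars (n : nat) : nat := #|{: upper n + upper n}|.

Definition indetX (R : numFieldType) (n : nat) : 'M[{mpoly R[nvars n]}]_n :=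
  \matrix_(i < n, j < n) 'X_(enum_rank (inl (sort_pair i j) : upper n + upper n)).

Definition indetY (R : numFieldType) (n : nat) : 'M[{mpoly R[nvars n]}]_n :=
  \matrix_(i < n, j < n) 'X_(enum_rank (inr (sort_pair i j) : upper n + upper n)).

(* Main.v *)
(** Expand the determinant over permutations s. If s (s i) != i for some i, flipping
    in both signings the sign of the edge {i, s i}, which occurs exactly once in the
    product indexed by s, negates that product; so the mean of the product vanishes.
    The involutions are the matchings M, with signature (-1)^|M|: fixed points
    contribute x_ii + y_ii, and a transposition e contributes
    (+- x_e +- y_e)^2, of mean x_e^2 + y_e^2, independently over e.
    Expanding the product of the x_e^2 + y_e^2 splits M into an ordered pair of
    vertex-disjoint matchings, perfect on the sets S_1 and S_2 that they cover. *)
Require Import Defs.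
From HB Require Import structures.
From mathcomp Require Import all_boot all_order all_algebra.
From mathcomp Require Import fingroup perm ring.
From mathcomp Require Import mpoly.

Set Implicit Arguments.
Unset Strict Implicit.
Unset Printing Implicit Defensive.

Import Order.TTheory GRing.Theory Num.Theory.
Local Open Scope ring_scope.

(** * Edges and matchings of the complete graph *)

Lemma edge_neq (n : nat) (e : edge n) : (val e).1 != (val e).2.
Proof. by have := valP e; apply: contraL => /eqP ->; rewrite ltnn. Qed.

(** The three cases mirror the branches of [signed_mx]. *)
Variant pair_spec (n : nat) (i j : 'I_n) : Prop :=
| PairDiag of i = j
| PairLt (e : edge n) of i = (val e).1 & j = (val e).2
| PairGt (e : edge n) of i = (val e).2 & j = (val e).1.

Lemma pairP (n : nat) (i j : 'I_n) : pair_spec i j.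
Proof.
case: (ltngtP i j) => [lt_ij|lt_ji|eq_ij].
- exact: (@PairLt _ _ _ (exist _ (i, j) lt_ij)).
- exact: (@PairGt _ _ _ (exist _ (j, i) lt_ji)).
- exact/PairDiag/val_inj.
Qed.

Lemma exists_ends (n : nat) (i j : 'I_n) :
  i != j -> exists e : edge n, ends e = [set i; j].
Proof.
case: (pairP i j) => [->|e -> -> _|e -> -> _]; first by rewrite eqxx.
- by exists e.
- by exists e; rewrite setUC.
Qed.

(** The order of the two components of an edge rules out the swapped pair. *)
Lemma ends_inj (n : nat) : injective (@ends n).
Proof.
move=> e f Eef; apply: val_inj.
have lt_e := valP e; have lt_f := valP f.
have: (val f).1 \in ends e by rewrite Eef !inE eqxx.
have: (val f).2 \in ends e by rewrite Eef !inE eqxx orbT.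
move: lt_e lt_f; rewrite !inE; case: (val e) (val f) => a b [c d] /=.
by move=> lt_ab lt_cd /pred2P[]d_ /pred2P[]c_; move: lt_cd; rewrite d_ c_ ?ltnn // ltnNge ltnW.
Qed.

Lemma ends_eq2 (n : nat) (e : edge n) (v w : 'I_n) :
  v \in ends e -> w \in ends e -> v != w -> ends e = [set v; w].
Proof.
by rewrite !inE => /pred2P[->|->] /pred2P[->|->]; rewrite ?eqxx //= setUC.
Qed.

(** Disjointness in working form: within a matching, any vertex of an edge determines that edge. *)
Lemma matching_completeP (n : nat) (M : {set edge n}) :
  reflect {in M &, forall (e f : edge n) v, v \in ends e -> v \in ends f -> e = f}
          (is_matching (complete_graph n) M).
Proof.
rewrite /is_matching subsetT /=.
apply: (iffP forall_inP) => [dM e f Me Mf v ve vf|injM e Me].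
  apply/eqP/negPn/negP => ne; move/forall_inP: (dM e Me) => /(_ f Mf).
  by rewrite ne => /pred0P/(_ v); rewrite /= ve vf.
apply/forall_inP => f Mf; apply/implyP/contraNT => /pred0Pn[v /andP[ve vf]].
by rewrite (injM e f Me Mf v).
Qed.

Lemma is_matching_induced (n : nat) (P : {set 'I_n}) (M : {set edge n}) :
  is_matching (induced (complete_graph n) P) M =
  is_matching (complete_graph n) M && (covered M \subset P).
Proof.
rewrite /is_matching subsetT /= andbC; congr (_ && _).
apply/subsetP/bigcupsP => sM e Me; first by have := sM e Me; rewrite !inE.
by rewrite !inE sM.
Qed.

(** A vertex of [P] left uncovered contributes a factor 0, so only perfect matchings of [P]
    survive. *)
Lemma matching_poly0 (A : comNzRingType) (n : nat) (P : {set 'I_n})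
    (w : edge n -> A) :
  matching_poly (induced (complete_graph n) P) (fun=> 0) w =
  \sum_(M | is_matching (complete_graph n) M && (covered M == P))
    (-1) ^+ #|M| * \prod_(e in M) w e ^+ 2.
Proof.
rewrite /matching_poly big_mkcond [RHS]big_mkcond /=; apply: eq_bigr => M _.
rewrite is_matching_induced setTI eqEsubset; case: (is_matching _ _) => //=.
case: (covered M \subset P) => //=.
case: (boolP (P \subset covered M)) => [|/subsetPn[v Pv Mv]].
  by rewrite -setD_eq0 => /eqP->; rewrite big_set0 mulr1.
by rewrite (bigD1 v) ?inE ?Mv //= mul0r mulr0 mul0r.
Qed.

(** * Matchings as involutive permutations *)

Definition edge_tperm (n : nat) (e : edge n) : 'S_n :=
  tperm (val e).1 (val e).2.

(** For a matching the transpositions are disjoint and commute, so the order of the enumeration is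
    immaterial. *)
Definition matching_perm (n : nat) (M : {set edge n}) : 'S_n :=
  (\prod_(e <- enum M) edge_tperm e)%g.

(** These are the 2-cycles of [s]. *)
Definition perm_matching (n : nat) (s : 'S_n) : {set edge n} :=
  [set e | (s (val e).1 == (val e).2) && (s (val e).2 == (val e).1)].

Lemma edge_tperm_id (n : nat) (e : edge n) (v : 'I_n) :
  v \notin ends e -> edge_tperm e v = v.
Proof. by rewrite !inE negb_or => /andP[v1 v2]; rewrite tpermD // eq_sym. Qed.

Lemma edge_tperm_ends (n : nat) (e : edge n) (v : 'I_n) :
  (edge_tperm e v \in ends e) = (v \in ends e).
Proof.
case: (boolP (v \in ends e)) => [|vNe]; last by rewrite edge_tperm_id ?(negbTE vNe).
by rewrite !inE => /pred2P[->|->]; rewrite ?tpermL ?tpermR eqxx ?orbT.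
Qed.

Lemma prod_edge_tperm_id (n : nat) (s : seq (edge n)) (v : 'I_n) :
  {in s, forall e, v \notin ends e} -> (\prod_(e <- s) edge_tperm e)%g v = v.
Proof.
elim: s => [|e s IHs] vNs; first by rewrite big_nil perm1.
rewrite big_cons permM edge_tperm_id ?vNs ?mem_head //.
by apply: IHs => f sf; rewrite vNs // inE sf orbT.
Qed.

Lemma matching_perm_id (n : nat) (M : {set edge n}) (v : 'I_n) :
  v \notin covered M -> matching_perm M v = v.
Proof.
move=> vNM; apply: prod_edge_tperm_id => e; rewrite mem_enum => Me.
by apply: contra vNM => ve; apply/bigcupP; exists e.
Qed.

Lemma matching_perm_edge (n : nat) (M : {set edge n}) (e : edge n) (v : 'I_n) :
  is_matching (complete_graph n) M -> e \in M -> v \in ends e ->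
  matching_perm M v = edge_tperm e v.
Proof.
move=> /matching_completeP injM Me ve; rewrite /matching_perm.
have sM f : f \in enum M -> f \in M by rewrite mem_enum.
have: e \in enum M by rewrite mem_enum.
(* Splitting the enumeration at [e] isolates one factor; the others involve edges of [M] that miss
   both ends of [e], hence fix [v] and its image. *)
move: (enum M) (enum_uniq M) sM => s us sM se.
case/splitPr: se us sM => s1 s2; move=> /[swap] sM.
rewrite cat_uniq /= negb_or => /and3P[_ /andP[e1 _] /andP[e2 _]].
have idM (f : edge n) w : f \in M -> f != e -> w \in ends e -> w \notin ends f.
  by move=> Mf ne we; apply: contra ne => wf; apply/eqP/(injM f e Mf Me w).
rewrite big_cat big_cons !permM /= (prod_edge_tperm_id (s := s1)).
  rewrite prod_edge_tperm_id // => f s2f; apply: idM; last by rewrite edge_tperm_ends.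
    by rewrite sM // mem_cat inE s2f !orbT.
  by apply: contraNneq e2 => <-.
move=> f s1f; apply: idM => //; first by rewrite sM // mem_cat s1f.
by apply: contraNneq e1 => <-.
Qed.

Lemma matching_permK (n : nat) (M : {set edge n}) :
  is_matching (complete_graph n) M -> involutive (matching_perm M).
Proof.
move=> mM v; case: (boolP (v \in covered M)) => [/bigcupP[e Me ve]|vNM].
  by rewrite !(matching_perm_edge mM Me) ?edge_tperm_ends // tpermK.
by rewrite !matching_perm_id.
Qed.

Lemma odd_matching_perm (n : nat) (M : {set edge n}) :
  matching_perm M = odd #|M| :> bool.
Proof.
rewrite cardE -(size_map val) -odd_perm_prod ?big_map //.
by rewrite all_map; apply/allP => e _; apply: edge_neq.
Qed.

Lemma perm_matching_ends (n : nat) (s : 'S_n) (e : edge n) (v : 'I_n) :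
  e \in perm_matching s -> v \in ends e -> s v \in ends e /\ s v != v.
Proof.
have ne := edge_neq e.
rewrite !inE => /andP[/eqP s1 /eqP s2] /pred2P[->|->];
  by rewrite ?s1 ?s2 eqxx ?orbT // eq_sym.
Qed.

Lemma perm_matching_is_matching (n : nat) (s : 'S_n) :
  is_matching (complete_graph n) (perm_matching s).
Proof.
apply/matching_completeP => e f Me Mf v ve vf; apply: ends_inj.
have [se nsv] := perm_matching_ends Me ve.
have [sf _] := perm_matching_ends Mf vf.
by rewrite (ends_eq2 se ve nsv) (ends_eq2 sf vf nsv).
Qed.

Lemma matching_permKset (n : nat) (M : {set edge n}) :
  is_matching (complete_graph n) M -> perm_matching (matching_perm M) = M.
Proof.
move=> mM; apply/setP => e; apply/idP/idP => Me.
  have e1 : (val e).1 \in ends e by rewrite !inE eqxx.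
  have [se ne] := perm_matching_ends Me e1.
  (* The first end of [e] is moved, so some [f] in [M] covers it; both [e] and [f] consist of this
     vertex and its image. *)
  case: (boolP ((val e).1 \in covered M)) => [/bigcupP[f Mf fe1]|]; last first.
    by move/matching_perm_id/eqP; rewrite (negbTE ne).
  suff -> : e = f by [].
  apply: ends_inj; rewrite (ends_eq2 se e1 ne) (ends_eq2 _ fe1 ne) //.
  by rewrite (matching_perm_edge mM Mf fe1) edge_tperm_ends.
rewrite inE !(matching_perm_edge mM Me) ?inE ?eqxx ?orbT //.
by rewrite tpermL tpermR !eqxx.
Qed.

Lemma perm_matchingK (n : nat) (s : 'S_n) :
  involutive s -> matching_perm (perm_matching s) = s.
Proof.
move=> sK; apply/permP => v.
have mM := perm_matching_is_matching s.
case: (altP (s v =P v)) => [sv|nsv].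
  rewrite matching_perm_id ?sv //; apply/bigcupP => -[e Me ve].
  by have [_] := perm_matching_ends Me ve; rewrite sv eqxx.
case: (pairP (s v) v) => [/eqP|e s1 v2|e s2 v1]; first by rewrite (negbTE nsv).
- have Me: e \in perm_matching s by rewrite inE -s1 -v2 sK !eqxx.
  by rewrite (matching_perm_edge mM Me) ?v2 ?tpermR ?inE ?eqxx ?orbT // -v2.
- have Me: e \in perm_matching s by rewrite inE -s2 -v1 sK !eqxx.
  by rewrite (matching_perm_edge mM Me) ?v1 ?tpermL ?inE ?eqxx // -v1.
Qed.

Lemma sum_involutions (V : zmodType) (n : nat) (F : 'S_n -> V) :
  \sum_(s : 'S_n | [forall i, s (s i) == i]) F s =
  \sum_(M | is_matching (complete_graph n) M) F (matching_perm M).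
Proof.
rewrite (reindex_onto (@matching_perm n) (@perm_matching n)); last first.
  by move=> s /forallP sK; apply: perm_matchingK => i; apply/eqP.
apply: eq_bigl => M; apply/andP/idP => [[_ /eqP<-]|mM].
  exact: perm_matching_is_matching.
by rewrite matching_permKset //; split=> //; apply/forallP => i; rewrite matching_permK.
Qed.

(** * Entries of signed matrices and products along a matching *)

Lemma signed_mx_diag (A : comNzRingType) (n : nat) (s : signing n)
    (M : 'M[A]_n) (i : 'I_n) : signed_mx s M i i = M i i.
Proof. by rewrite mxE !insubN //= ltnn. Qed.

Lemma signed_mx_upper (A : comNzRingType) (n : nat) (s : signing n)
    (M : 'M[A]_n) (e : edge n) :
  signed_mx s M (val e).1 (val e).2 = (-1) ^+ s e * M (val e).1 (val e).2.
Proof. by rewrite mxE -surjective_pairing valK. Qed.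

Lemma signed_mx_lower (A : comNzRingType) (n : nat) (s : signing n)
    (M : 'M[A]_n) (e : edge n) :
  signed_mx s M (val e).2 (val e).1 = (-1) ^+ s e * M (val e).2 (val e).1.
Proof.
by rewrite mxE insubN /= -?leqNgt ?(ltnW (valP e)) // -surjective_pairing valK.
Qed.

Lemma signed_mx_sym (A : comNzRingType) (n : nat) (s : signing n)
    (M : 'M[A]_n) : M^T = M -> (signed_mx s M)^T = signed_mx s M.
Proof.
move=> symM; apply/matrixP => i j; rewrite mxE.
have Mji i' j' : M i' j' = M j' i' by rewrite -[in LHS]symM mxE.
by case: (pairP i j) => [->//|e -> ->|e -> ->];
  rewrite signed_mx_upper signed_mx_lower Mji.
Qed.

Definition flip_sign (n : nat) (e : edge n) (s : signing n) : signing n :=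
  [ffun f => s f (+) (f == e)].

Lemma flip_signK (n : nat) (e : edge n) : involutive (flip_sign e).
Proof. by move=> s; apply/ffunP => f; rewrite !ffunE addbK. Qed.

Lemma signed_mx_flip (A : comNzRingType) (n : nat) (e : edge n)
    (s : signing n) (M : 'M[A]_n) (i j : 'I_n) : i != j ->
  signed_mx (flip_sign e s) M i j =
    (-1) ^+ (ends e == [set i; j]) * signed_mx s M i j.
Proof.
case: (pairP i j) => [->|f -> -> _|f -> -> _]; first by rewrite eqxx.
- rewrite !signed_mx_upper ffunE signr_addb -(inj_eq (@ends_inj n)) eq_sym.
  by rewrite mulrA [in RHS](mulrC ((-1) ^+ _)).
- rewrite !signed_mx_lower ffunE signr_addb -(inj_eq (@ends_inj n)) eq_sym.
  by rewrite mulrA [in RHS](mulrC ((-1) ^+ _)) [in RHS]setUC.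
Qed.

(** Uncovered vertices are fixed points, and each edge yields two mirror entries, equal by
    symmetry. *)
Lemma prod_matching_perm (A : comNzRingType) (n : nat) (Z : 'M[A]_n)
    (M : {set edge n}) :
  Z^T = Z -> is_matching (complete_graph n) M ->
  \prod_i Z i (matching_perm M i) =
    (\prod_(i in ~: covered M) Z i i)
    * \prod_(e in M) Z (val e).1 (val e).2 ^+ 2.
Proof.
move=> symZ mM; have Zji i j : Z i j = Z j i by rewrite -[in LHS]symZ mxE.
rewrite (bigID (mem (covered M))) /= mulrC; congr (_ * _).
  by apply: eq_big => i; rewrite ?inE // => /matching_perm_id->.
(* Padding with empty sets makes the family pairwise disjoint over all edges, as
   [partition_disjoint_bigcup] asks. *)
have -> : covered M = \bigcup_e (if e \in M then ends e else set0).
  by rewrite /covered big_mkcond.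
rewrite partition_disjoint_bigcup /=.
  rewrite [RHS]big_mkcond; apply: eq_bigr => e _.
  case: ifP => [Me|_]; last by rewrite big_set0.
  have ne := edge_neq e.
  rewrite big_setU1 ?inE //= big_set1 !(matching_perm_edge mM Me) ?inE ?eqxx ?orbT //.
  by rewrite tpermL tpermR [Z _ (val e).1]Zji expr2.
move=> e f nef; case: ifP => Me; last by rewrite -setI_eq0 set0I.
case: ifP => Mf; last by rewrite -setI_eq0 setI0.
apply/pred0P => v /=; apply: contraNF nef => /andP[ve vf].
by move/matching_completeP: mM => /(_ e f Me Mf v ve vf) ->.
Qed.

(** * Averages over signings *)

Lemma sum_signings_prod (A : comNzRingType) (n : nat) (F : edge n -> bool -> A) :
  \sum_(s : signing n) \prod_e F e (s e) = \prod_e (F e true + F e false).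
Proof. by rewrite -bigA_distr_bigA; apply: eq_bigr => e _; rewrite big_bool. Qed.

(* Averaging over one of the two signings already kills the cross terms. *)
Lemma sum_signings_sqr (A : comNzRingType) (n : nat) (x y : edge n -> A)
    (M : {set edge n}) (t : signing n) :
  \sum_(s : signing n)
     \prod_(e in M) ((-1) ^+ s e * x e + (-1) ^+ t e * y e) ^+ 2 =
  #|{: signing n}|%:R * \prod_(e in M) (x e ^+ 2 + y e ^+ 2).
Proof.
pose F e (b : bool) := if e \in M then ((-1) ^+ b * x e + (-1) ^+ t e * y e) ^+ 2 else 1.
transitivity (\sum_(s : signing n) \prod_e F e (s e)).
  by apply: eq_bigr => s _; rewrite big_mkcond.
(* Every edge yields a factor 2, as 1 + 1 outside [M] and as the sum of two squares inside; together
   these make the number of signings. *)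
rewrite sum_signings_prod card_ffun card_bool natrX -prodr_const.
rewrite (big_mkcond (mem M)) -big_split; apply: eq_bigr => e _ /=.
rewrite /F; case: ifP => _; last by rewrite mulr1.
by rewrite expr0 expr1; case: (t e); rewrite ?expr1 ?expr0; ring.
Qed.

Lemma sum_signings_noninvolution (R : numFieldType) (A : comAlgType R) (n : nat)
    (X Y : 'M[A]_n) (s : 'S_n) : ~~ [forall i, s (s i) == i] ->
  \sum_(t : signing n * signing n)
    \prod_i (signed_mx t.1 X + signed_mx t.2 Y) i (s i) = 0.
Proof.
rewrite negb_forall => /existsP[i nssi]; set S := \sum_t _.
have nsi : i != s i by apply: contraNneq nssi => Ei; rewrite -!Ei.
have [e Ee] := exists_ends nsi.
pose flip2 (t : signing n * signing n) := (flip_sign e t.1, flip_sign e t.2).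
have flip2K : involutive flip2 by case=> t1 t2; rewrite /flip2 /= !flip_signK.
have SN : S = - S.
  rewrite {1}/S (reindex_inj (inv_inj flip2K)) -sumrN; apply: eq_bigr => t _ /=.
  rewrite (bigD1 i) //= [in RHS](bigD1 i) //= -mulNr; congr (_ * _).
    by rewrite mxE [in RHS]mxE !signed_mx_flip // Ee eqxx !mulN1r -opprD.
  apply: eq_bigr => k nki; rewrite mxE [in RHS]mxE.
  case: (altP (k =P s k)) => [<-|nsk]; first by rewrite !signed_mx_diag.
  rewrite !signed_mx_flip // Ee.
  (* The flipped edge occurs in no other factor: equality with [k != i] would force [k = s i] and
     [s k = i], hence [s (s i) = i]. *)
  suff /negbTE-> : [set i; s i] != [set k; s k] by rewrite !mul1r.
  apply: contra nssi => /eqP/setP Eik.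
  have := Eik k; rewrite !inE eqxx (negbTE nki) /= => /eqP ks.
  by have := Eik i; rewrite !inE eqxx ks (negbTE nsi) eq_sym /= => <-.
have S2 : S *+ 2 = 0 by rewrite mulr2n {1}SN addNr.
(* The scalar 2 is invertible in [R], so [S *+ 2 = 0] gives [S = 0]. *)
rewrite -[S]scale1r -(mulVf (_ : 2%:R != 0 :> R)) ?pnatr_eq0 // -scalerA.
by rewrite scaler_nat S2 scaler0.
Qed.

Lemma mean_det_signed (R : numFieldType) (A : comAlgType R) (n : nat)
    (X Y : 'M[A]_n) : X^T = X -> Y^T = Y ->
  uniform_mean (fun t : signing n * signing n =>
    \det (signed_mx t.1 X + signed_mx t.2 Y)) =
  \sum_(M | is_matching (complete_graph n) M)
    (-1) ^+ #|M| * (\prod_(i in ~: covered M) (X i i + Y i i))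
    * \prod_(e in M) (edge_weight X e ^+ 2 + edge_weight Y e ^+ 2).
Proof.
move=> symX symY; rewrite /uniform_mean /determinant exchange_big /=.
rewrite (bigID (fun s : 'S_n => [forall i, s (s i) == i])) /= [X in _ + X]big1; last first.
  by move=> s inv's; rewrite -mulr_sumr sum_signings_noninvolution ?mulr0.
rewrite addr0 sum_involutions scaler_sumr; apply: eq_bigr => M mM.
set c := #|{: signing n}|; have c0 : c%:R != 0 :> R.
  by rewrite pnatr_eq0 /c card_ffun card_bool expn_eq0.
pose wX := edge_weight X; pose wY := edge_weight Y.
pose D := \prod_(i in ~: covered M) (X i i + Y i i).
(* With [t2] fixed, the inner sum over [t1] gives a factor [c] and no longer depends on [t2]; the
   outer sum gives the second [c], and the normalisation cancels both. *)
transitivity ((#|{: signing n * signing n}|%:R : R)^-1 *: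
    \sum_(t2 : signing n) \sum_(t1 : signing n) ((-1) ^+ #|M| * D *
      \prod_(e in M) ((-1) ^+ t1 e * wX e + (-1) ^+ t2 e * wY e) ^+ 2)).
  rewrite exchange_big pair_big /=; congr (_ *: _); apply: eq_bigr => t _.
  rewrite odd_matching_perm signr_odd prod_matching_perm //; last first.
    by rewrite linearD /= !signed_mx_sym.
  rewrite mulrA; congr (_ * _ * _).
    by apply: eq_bigr => i _; rewrite mxE !signed_mx_diag.
  by apply: eq_bigr => e _; rewrite mxE !signed_mx_upper.
rewrite (eq_bigr (fun=> (-1) ^+ #|M| * D
    * (c%:R * \prod_(e in M) (wX e ^+ 2 + wY e ^+ 2)))); last first.
  by move=> t2 _; rewrite -mulr_sumr sum_signings_sqr.
rewrite sumr_const card_prod -/c mulrCA mulr_natl -mulrnA -scaler_nat scalerA.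
by rewrite mulVf ?scale1r // natrM mulf_neq0.
Qed.

(** * Splitting a matching into an ordered pair of matchings *)

Lemma prodD_subsets (A : comNzRingType) (I : finType) (a b : I -> A) (M : {set I}) :
  \prod_(i in M) (a i + b i) =
  \sum_(K : {set I} | K \subset M) (\prod_(i in K) a i) * \prod_(i in M :\: K) b i.
Proof.
(* Outside [M] the factor 1 is written 0 + 1, which kills every subset [K] not contained in [M]. *)
transitivity (\prod_i ((if i \in M then a i else 0) + (if i \in M then b i else 1))).
  by rewrite big_mkcond; apply: eq_bigr => i _; case: ifP => //; rewrite add0r.
rewrite bigA_distr [RHS]big_mkcond; apply: eq_bigr => K _; case: ifPn => [sKM|].
  rewrite [X in _ = X * _]big_mkcond [X in _ = _ * X]big_mkcond -big_split.
  apply: eq_bigr => i _ /=; rewrite inE; case: ifP => [/(subsetP sKM)->|_] /=.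
    by rewrite mulr1.
  by rewrite mul1r.
by case/subsetPn => i Ki Mi; rewrite (bigD1 i) //= Ki (negbTE Mi) mul0r.
Qed.

(** The equation on the left says that [M] and [N] share no edge, in the form that [reindex_onto]
    produces. Inside a matching, distinct edges share no vertex, which turns this into disjointness
    of the covered sets. *)
Lemma matching_setU (n : nat) (M N : {set edge n}) :
  is_matching (complete_graph n) (M :|: N) && ((M :|: N) :\: M == N) =
  [&& is_matching (complete_graph n) M, is_matching (complete_graph n) N
    & [disjoint covered M & covered N]].
Proof.
rewrite setDUl setDv set0U; apply/andP/and3P.
  move=> [/matching_completeP injU /eqP dNM].
  have UM e : e \in M -> e \in M :|: N by rewrite inE => ->.
  have UN e : e \in N -> e \in M :|: N by rewrite inE orbC => ->.
  split.
  - by apply/matching_completeP => e f /UM Me /UM Mf; apply: injU.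
  - by apply/matching_completeP => e f /UN Me /UN Mf; apply: injU.
  apply/pred0P => v /=; apply/negP => /andP[/bigcupP[e Me ve] /bigcupP[f Nf vf]].
  have Eef := injU e f (UM e Me) (UN f Nf) v ve vf.
  by move: Nf; rewrite -dNM inE -Eef Me.
move=> [/matching_completeP injM /matching_completeP injN /pred0P dMN].
have dis e f v : e \in M -> f \in N -> v \in ends e -> v \in ends f -> False.
  move=> Me Nf ve vf; have /negP[] := negbT (dMN v).
  by rewrite /=; apply/andP; split; apply/bigcupP; [exists e | exists f].
split.
  apply/matching_completeP => e f /setUP[Me|Ne] /setUP[Mf|Nf] v ve vf.
  - exact: injM vf.
  - by case: (dis e f v).
  - by case: (dis f e v).
  - exact: injN vf.
apply/eqP/setDidPl; rewrite disjoint_sym; apply/pred0P => e /=.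
by apply/negP => /andP[Me Ne]; apply: (dis e e (val e).1); rewrite ?inE ?eqxx.
Qed.

Lemma covered_setU (n : nat) (M N : {set edge n}) :
  covered (M :|: N) = covered M :|: covered N.
Proof. exact: bigcup_setU. Qed.

Lemma sum_matchings_split (A : comNzRingType) (n : nat) (d : 'I_n -> A)
    (x y : edge n -> A) :
  \sum_(M | is_matching (complete_graph n) M)
    (-1) ^+ #|M| * (\prod_(i in ~: covered M) d i)
    * \prod_(e in M) (x e ^+ 2 + y e ^+ 2) =
  \sum_(S : {set 'I_n}) (\prod_(i in ~: S) d i)
    * (\sum_(P : {set 'I_n} * {set 'I_n}
             | [disjoint P.1 & P.2] && (P.1 :|: P.2 == S))
         matching_poly (induced (complete_graph n) P.1) (fun=> 0) x
         * matching_poly (induced (complete_graph n) P.2) (fun=> 0) y).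
Proof.
pose wt (N : {set edge n} * {set edge n}) :=
  (\prod_(i in ~: (covered N.1 :|: covered N.2)) d i)
  * (((-1) ^+ #|N.1| * \prod_(e in N.1) x e ^+ 2)
     * ((-1) ^+ #|N.2| * \prod_(e in N.2) y e ^+ 2)).
pose pairs (N : {set edge n} * {set edge n}) :=
  [&& is_matching (complete_graph n) N.1, is_matching (complete_graph n) N.2
    & [disjoint covered N.1 & covered N.2]].
transitivity (\sum_(N | pairs N) wt N).
  under eq_bigr => M _ do rewrite prodD_subsets mulr_sumr.
  rewrite pair_big_dep /=.
  (* A matching with a chosen subset becomes the pair of that subset, carrying [x], and its
     complement, carrying [y]. *)
  rewrite (reindex_onto (fun N : {set edge n} * {set edge n} => (N.1 :|: N.2, N.1))
    (fun N => (N.2, N.1 :\: N.2))) /=; last first.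
    by case=> M K /= /andP[_ /setIidPr sKM]; rewrite -{1}sKM setID.
  apply: eq_big => [[M N]|[M N]] /=.
    by rewrite subsetUl andbT xpair_eqE eqxx matching_setU.
  case/andP=> _ /eqP[dNM]; rewrite dNM /wt /= covered_setU cardsU.
  (* Sizes add for disjoint sets, so the sign factors over the pair. *)
  have -> : M :&: N = set0 by rewrite -dNM setDE setICA setICr setI0.
  by rewrite cards0 subn0 exprD; ring.
(* Pairs are grouped by the union [S] of their covered sets, then by the two covered sets
   themselves. *)
rewrite (partition_big (fun N => covered N.1 :|: covered N.2) xpredT) //=.
apply: eq_bigr => S _; rewrite mulr_sumr.
rewrite (partition_big (fun N => (covered N.1, covered N.2))
  (fun P => [disjoint P.1 & P.2] && (P.1 :|: P.2 == S))) /=; last first.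
  by move=> N /andP[/and3P[_ _ ->]].
apply: eq_bigr => -[P1 P2] /= /andP[dP /eqP<-].
rewrite !matching_poly0 big_distrlr pair_big mulr_sumr /=.
apply: eq_big => [[M N]|[M N] /andP[/andP[_ /eqP EU]] _] /=; last by rewrite /wt /= EU.
rewrite /pairs xpair_eqE /=; apply/idP/idP.
  by case/andP=> /andP[/and3P[-> -> _] _] /andP[-> ->].
by case/andP=> /andP[-> /eqP->] /andP[-> /eqP->]; rewrite dP !eqxx.
Qed.

Theorem proposition4p5 (R : numFieldType) (n : nat) :
  let X := indetX R n in
  let Y := indetY R n in
  uniform_mean (fun s : signing n * signing n =>
    \det (signed_mx s.1 X + signed_mx s.2 Y))
  = \sum_(S : {set 'I_n})
      (\prod_(i in ~: S) (X i i + Y i i))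
      * (\sum_(P : {set 'I_n} * {set 'I_n}
               | [disjoint P.1 & P.2] && (P.1 :|: P.2 == S))
           matching_poly (induced (complete_graph n) P.1)
             (fun=> 0) (edge_weight X)
           * matching_poly (induced (complete_graph n) P.2)
             (fun=> 0) (edge_weight Y)).
Proof.
move=> X Y.
(* Mirror entries carry the same indeterminate; this symmetry is all that the general identities ask
   of [X] and [Y]. *)
have sort_pairC (i j : 'I_n) : sort_pair i j = sort_pair j i.
  by apply: val_inj => /=; case: ltngtP => // /val_inj->.
have symX : X^T = X by apply/matrixP => i j; rewrite !mxE sort_pairC.
have symY : Y^T = Y by apply/matrixP => i j; rewrite !mxE sort_pairC.
by rewrite (mean_det_signed symX symY) (sum_matchings_split (fun i => X i i + Y i i)).
Qed.
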